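(* Let $C>1$ be a constant and let $u:\mathbb{R}^n\to\mathbb{R}$ be a convex spacelike entire solution of $$\sum_{i,j=1}^n\left(\delta_{ij}+\frac{u_iu_j}{1-|Du|^2}\right)u_{ij}=C\sqrt{1-|Du|^2}-1\quad\text{on }\mathbb{R}^n$$ with $u(0)=0$. For $h>0$ put $u^h(x)=\frac{u(hx)}{h}$. Then the limit $$V_u(x)=\lim_{h\to\infty}u^h(x)$$ exists for all $x\in\mathbb{R}^n$, and $V_u$ is a positively homogeneous degree one convex function on $\mathbb{R}^n$. Moreover, for every $x\in\mathbb{R}^n$ and every $\delta>0$ there exists $y\in\mathbb{R}^n$ with $|y-x|=\delta$ and $$|V_u(x)-V_u(y)|=\sqrt{1-\frac{1}{C^2}}\;\delta .$$ In particular, $|DV_u(x)|=\sqrt{1-\frac1{C^2}}$ at every point $x$ of differentiability of $V_u$.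
   Context: Here $u_i,u_{ij}$ denote partial derivatives of $u$. Spacelike means $|Du|<1$ on $\mathbb{R}^n$, so that the graph of $u$ is a spacelike hypersurface of Minkowski space $\mathbb{R}^{n,1}$. Solutions are classical. Positively homogeneous of degree one means $V_u(\lambda x)=\lambda V_u(x)$ for all $\lambda>0$. *)

(* Defs.v *)
From HB Require Import structures.
From mathcomp Require Import all_boot all_order all_algebra.
From mathcomp Require Import all_classical all_reals all_analysis.

Set Implicit Arguments.
Unset Strict Implicit.
Unset Printing Implicit Defensive.

Import Order.TTheory GRing.Theory Num.Theory.
Import numFieldNormedType.Exports.

Local Open Scope classical_set_scope.
Local Open Scope ring_scope.

(* The library norm `|v| on 'rV[R]_n is the sup norm, which induces the same
   topology (hence the same notions of continuity and differentiability) but is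
   not the norm of the Euclidean space R^n. *)
Definition enorm (R : realType) (n : nat) (v : 'rV[R]_n) : R :=
  Num.sqrt (\sum_(i < n) v 0 i ^+ 2).

Definition partial (R : realType) (n : nat) (i : 'I_n) (f : 'rV[R]_n -> R)
    (x : 'rV[R]_n) : R :=
  'D_(delta_mx 0 i) f x.

Definition grad (R : realType) (n : nat) (f : 'rV[R]_n -> R) (x : 'rV[R]_n) :
    'rV[R]_n :=
  \row_(i < n) partial i f x.

Definition C1 (R : realType) (n : nat) (f : 'rV[R]_n -> R) : Prop :=
  (forall x, differentiable f x) /\ (forall i, continuous (partial i f)).

Definition C2 (R : realType) (n : nat) (f : 'rV[R]_n -> R) : Prop :=
  C1 f /\ (forall i, C1 (partial i f)).

Definition spacelike (R : realType) (n : nat) (u : 'rV[R]_n -> R) : Prop :=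
  forall x, enorm (grad u x) < 1.

Definition convex (R : realType) (n : nat) (f : 'rV[R]_n -> R) : Prop :=
  convex_function [set: convex_lmodType 'rV[R]_n] f.

Definition solves_equation (R : realType) (n : nat) (C : R)
    (u : 'rV[R]_n -> R) : Prop :=
  forall x : 'rV[R]_n,
    \sum_(i < n) \sum_(j < n)
      ((i == j)%:R
        + partial i u x * partial j u x / (1 - enorm (grad u x) ^+ 2))
      * partial j (partial i u) x
    = C * Num.sqrt (1 - enorm (grad u x) ^+ 2) - 1.

Definition rescaling (R : realType) (n : nat) (u : 'rV[R]_n -> R) (h : R)
    (x : 'rV[R]_n) : R :=
  u (h *: x) / h.

(* Only meaningful at points x where the limit exists: lim is a total operator
   with an unspecified value otherwise. *)
Definition blowdown (R : realType) (n : nat) (u : 'rV[R]_n -> R)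
    (x : 'rV[R]_n) : R :=
  lim (rescaling u h x @[h --> +oo]).

Definition pos_homogeneous1 (R : realType) (n : nat) (f : 'rV[R]_n -> R) :
    Prop :=
  forall (l : R) (x : 'rV[R]_n), 0 < l -> f (l *: x) = l * f x.

(* Main.v *)
Require Import Defs.
From HB Require Import structures.
From mathcomp Require Import all_boot all_order all_algebra.
From mathcomp Require Import all_classical all_reals all_analysis.
From mathcomp Require Import ring lra.

Import Order.TTheory GRing.Theory Num.Theory.
Import numFieldNormedType.Exports.

Local Open Scope classical_set_scope.
Local Open Scope ring_scope.

Set Implicit Arguments.
Unset Strict Implicit.

(** Convexity makes the left-hand side of the equation nonnegative, hence
    [|Du| <= k] with [k = sqrt (1 - 1/C^2)], and it makes [u(hx)/h] nondecreasing
    in [h]; so the blowdown [V] exists, is the supremum of the rescalings, and is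
    [k]-Lipschitz.  Conversely, for [a < k], a hyperboloid
    [a * sqrt (|y - x|^2 + eps^2)] with [eps] large has gradient at most [a] and
    so small a Hessian that [u] minus it has no interior maximum in a ball
    around [x], uniformly in [x] and in the radius.  So on every sphere of radius
    [rho] around [x] the function [u] exceeds [u x + a (rho - eps)] somewhere;
    after rescaling [eps] disappears, and [a -> k] gives the reverse inequality
    for [V]. *)

(** * Euclidean inner product and norm; compactness of balls and spheres *)

Section euclidean.
Context {R : realType} {n : nat}.
Implicit Types (x y v w : 'rV[R]_n) (f : 'rV[R]_n -> R) (t : R).

Definition dot v w : R := \sum_(i < n) v 0 i * w 0 i.

Lemma dotDr v x y : dot v (x + y) = dot v x + dot v y.
Proof. by rewrite -big_split; apply: eq_bigr => i _; rewrite mxE mulrDr. Qed.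

Lemma dotZr v t x : dot v (t *: x) = t * dot v x.
Proof. by rewrite mulr_sumr; apply: eq_bigr => i _; rewrite mxE mulrCA. Qed.

Lemma dotC v w : dot v w = dot w v.
Proof. by apply: eq_bigr => i _; rewrite mulrC. Qed.

Lemma dot_ge0 v : 0 <= dot v v.
Proof. by apply: sumr_ge0 => i _; rewrite -expr2 sqr_ge0. Qed.

Lemma enorm_sqr v : enorm v ^+ 2 = dot v v.
Proof.
rewrite /enorm sqr_sqrtr; last by apply: sumr_ge0 => i _; rewrite sqr_ge0.
by apply: eq_bigr => i _; rewrite expr2.
Qed.

Lemma enormD_sqr v w :
  enorm (v + w) ^+ 2 = enorm v ^+ 2 + 2 * dot v w + enorm w ^+ 2.
Proof.
by rewrite !enorm_sqr dotDr ![dot (v + w) _]dotC !dotDr (dotC w v); ring.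
Qed.

Lemma enorm_ge0 v : 0 <= enorm v.
Proof. exact: sqrtr_ge0. Qed.

Lemma enormE v : enorm v = Num.sqrt (dot v v).
Proof. by rewrite -enorm_sqr sqrtr_sqr ger0_norm// enorm_ge0. Qed.

Lemma enormZ t v : enorm (t *: v) = `|t| * enorm v.
Proof.
by rewrite !enormE dotZr dotC dotZr mulrA -expr2 sqrtrM ?sqr_ge0// sqrtr_sqr.
Qed.

Lemma enormN v : enorm (- v) = enorm v.
Proof. by rewrite -scaleN1r enormZ normrN1 mul1r. Qed.

Lemma enorm0 : enorm (0 : 'rV[R]_n) = 0.
Proof. by rewrite -(scale0r (0 : 'rV[R]_n)) enormZ normr0 mul0r. Qed.

Lemma dot_le_enorm v w : dot v w <= enorm v * enorm w.
Proof.
have [w0|w0] := eqVneq (enorm w) 0.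
  have w00 : w = 0.
    apply/rowP => i; rewrite mxE; apply/eqP; rewrite -sqrf_eq0.
    have : dot w w == 0 by rewrite -enorm_sqr w0 expr0n.
    rewrite psumr_eq0; first by move/allP => /(_ i (mem_index_enum _)); rewrite expr2.
    by move=> j _; rewrite -expr2 sqr_ge0.
  by rewrite w0 mulr0 w00 -(scale0r (0 : 'rV[R]_n)) dotZr mul0r.
have wp : 0 < enorm w ^+ 2 by rewrite exprn_gt0// lt_neqAle eq_sym w0 enorm_ge0.
rewrite (le_trans (ler_norm _))// -ler_sqr ?nnegrE ?mulr_ge0 ?enorm_ge0//.
rewrite real_normK ?num_real// exprMn.
(* Cauchy-Schwarz: the vector [|w|^2 v - (v.w) w] has nonnegative square, which is [|w|^2] times the
   desired difference. *)
have := dot_ge0 (enorm w ^+ 2 *: v + (- dot v w) *: w).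
rewrite dotDr !dotZr ![dot (_ + _) _]dotC !dotDr !dotZr -!enorm_sqr (dotC w v).
rewrite (_ : _ + _ = enorm w ^+ 2 * (enorm v ^+ 2 * enorm w ^+ 2 - dot v w ^+ 2)).
  by rewrite pmulr_rge0// subr_ge0.
by ring.
Qed.

Lemma coord_le_enorm v i : `|v 0 i| <= enorm v.
Proof.
rewrite -ler_sqr ?nnegrE ?enorm_ge0// real_normK ?num_real// enorm_sqr.
rewrite /dot (bigD1 i)//= -expr2 lerDl.
by apply: sumr_ge0 => j _; rewrite -expr2 sqr_ge0.
Qed.

(** Bridge to the sup norm, in which boundedness and the remainder of a differential are
    expressed. *)
Lemma norm_le_enorm v : `|v| <= enorm v.
Proof.
rewrite [leLHS]mx_normrE; apply/bigmax_leP; split; first exact: enorm_ge0.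
by case=> i j _ /=; rewrite ord1; exact: coord_le_enorm.
Qed.

Lemma enorm_continuous : continuous (@enorm R n).
Proof.
suff sumc : continuous (fun v : 'rV[R]_n => \sum_(i < n) v 0 i ^+ 2).
  move=> x; apply: (@continuous_comp _ _ _ _ Num.sqrt); first exact: sumc.
  exact: sqrt_continuous.
apply: (@continuous_big R) => [|i _]; first exact: add_continuous.
move=> x; apply: (@continuous_comp _ _ _ (fun v : 'rV[R]_n => v 0 i)
  (fun a : R => a ^+ 2)); first exact: coord_continuous.
exact: exprn_continuous.
Qed.

Lemma enormB_continuous x : continuous (fun y => enorm (y - x)).
Proof.
have subx : continuous (fun y : 'rV[R]_n => y - x).
  move=> y; apply: continuousB; first exact: cvg_id.
  exact: cst_continuous.
move=> y; apply: (@continuous_comp _ _ _ (fun y => y - x) (@enorm R n)).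
  exact: subx.
exact: enorm_continuous.
Qed.

Lemma closed_ball_compact x t : compact [set y | enorm (y - x) <= t].
Proof.
apply: bounded_closed_compact.
  exists (`|x| + t); split; first by rewrite num_real.
  move=> M HM y /= yt; rewrite (le_trans _ (ltW HM))//.
  rewrite -[y in leLHS](subrK x) (le_trans (ler_normD _ _))// addrC lerD2l.
  exact: le_trans (norm_le_enorm _) yt.
apply: (@closed_comp _ _ (fun y => enorm (y - x)) [set z | z <= t]).
  by move=> y _; exact: enormB_continuous.
exact: closed_le.
Qed.

Lemma sphere_compact x t : compact [set y | enorm (y - x) = t].
Proof.
apply: (subclosed_compact _ (@closed_ball_compact x t)).
  apply: (@closed_comp _ _ (fun y => enorm (y - x)) [set z | z = t]).
    by move=> y _; exact: enormB_continuous.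
  exact: closed_eq.
by move=> y /= ->.
Qed.

Lemma convexP f : convex f <-> forall x y t, 0 <= t <= 1 ->
  f (t *: x + (1 - t) *: y) <= t * f x + (1 - t) * f y.
Proof.
split=> [cf x y t t01|cf t x y _ _].
  pose p := Itv01 (andP t01).1 (andP t01).2.
  by have := cf p x y; apply; rewrite inE.
by apply: cf; apply/andP; split.
Qed.

End euclidean.

(** * First and second derivative tests in one variable *)

Section one_variable.
Context {R : realType}.
Implicit Types (g : R -> R) (x b c e K M t : R).

Lemma is_derive_approx g x b : is_derive x 1 g b -> forall e, 0 < e ->
  \forall t \near 0, `|g (x + t) - g x - t * b| <= e * `|t|.
Proof.
move=> [/cvg_ex[l dg] gb] e e0.
have lb : l = b by rewrite -gb; apply/esym/cvg_lim.
move: dg; rewrite {}lb => /cvgrPdist_le /(_ _ e0).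
rewrite /dnbhs /within /= => H; near=> t.
have [->|t0] := eqVneq t 0.
  by rewrite addr0 subrr mul0r subr0 normr0 mulr0.
have : t != 0 -> `|b - t^-1 *: ((g \o shift x) (t *: 1) - g x)| <= e.
  by near: t; exact: H.
move=> /(_ t0) /=; rewrite [t *: 1]mulr1 (addrC t) => H1.
rewrite -ler_pdivrMr ?normr_gt0// -normf_div; apply: le_trans H1; rewrite distrC.
rewrite (_ : (_ - _) / t = t^-1 *: (g (x + t) - g x) - b)//.
by rewrite [_ *: _]mulrC; field.
Unshelve. all: by end_near. Qed.

(** Dividing by [t > 0] and letting [t] tend to 0 removes the quadratic term. *)
Lemma derive_le_of_quadratic g b c K : is_derive (0 : R) 1 g b ->
  (\forall t \near 0, 0 < t -> g t <= g 0 + t * c + K * t ^+ 2) -> b <= c.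
Proof.
move=> dg gK; apply/ler_addgt0Pr => e e0.
have e20 : 0 < e / 2 by rewrite divr_gt0.
have H1 := is_derive_approx dg e20.
(* This threshold on [t] forces [K * t <= e / 2]; adding 1 covers [K = 0]. *)
have K0 : 0 < e / 2 / (`|K| + 1) by rewrite divr_gt0// ltr_wpDl.
have H2 := @nbhs0_lt R R _ K0.
have /nbhs_ballP[d /= d0 H] :
    \forall t \near 0, [/\ `|g (0 + t) - g 0 - t * b| <= e / 2 * `|t|,
      0 < t -> g t <= g 0 + t * c + K * t ^+ 2 & `|t| < e / 2 / (`|K| + 1)].
  near=> t; split; near: t; [exact: H1|exact: gK|exact: H2].
have d20 : 0 < d / 2 by rewrite divr_gt0.
have [] := H (d / 2).
  by rewrite /ball /= sub0r normrN gtr0_norm// ltr_pdivrMr// ltr_pMr// ltr1n.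
move: (d / 2) d20 => t t0.
rewrite add0r (gtr0_norm t0) ler_norml => /andP[h1 _] /(_ t0) h2.
rewrite ltr_pdivlMr ?ltr_wpDl// => h3.
have Kt : K * t <= e / 2.
  rewrite (le_trans _ (ltW h3))// mulrC ler_pM2l//.
  by rewrite (le_trans (ler_norm _))// lerDl.
have : t * b <= t * (c + e).
  have : t * (K * t) <= t * (e / 2) by rewrite ler_pM2l.
  by rewrite expr2 in h2; move: h1 h2; lra.
by rewrite ler_pM2l.
Unshelve. all: by end_near. Qed.

(** If [b > M], the function [g t + g (- t) - M * t ^+ 2] has a derivative close to
    [2 * (b - M) * t], so it increases strictly to the right of 0, against the bound on second
    differences. *)
Lemma second_derive_le g g' b M : (forall t, is_derive t 1 g (g' t)) ->
    is_derive (0 : R) 1 g' b ->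
    (\forall t \near 0, g t + g (- t) - 2 * g 0 <= M * t ^+ 2) -> b <= M.
Proof.
move=> dg dg' gM; rewrite leNgt; apply/negP => Mb.
(* The estimate is used at [c] and at [- c]; the two errors add up to [(b - M) * c], half of the
   main term. *)
have e0 : 0 < (b - M) / 2 by rewrite divr_gt0// subr_gt0.
have H1 := is_derive_approx dg' e0.
have /nbhs_ballP[d /= d0 H] :
    \forall t \near 0, `|g' (0 + t) - g' 0 - t * b| <= (b - M) / 2 * `|t| /\
      g t + g (- t) - 2 * g 0 <= M * t ^+ 2.
  near=> t; split; near: t; [exact: H1|exact: gM].
have {}H t : `|t| < d -> `|g' t - g' 0 - t * b| <= (b - M) / 2 * `|t| /\
      g t + g (- t) - 2 * g 0 <= M * t ^+ 2.
  by move=> td; have := H t; rewrite /ball /= sub0r normrN add0r; exact.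
pose m t := g t + g (- t) - M * t ^+ 2.
pose m' t := g' t - g' (- t) - M * (2 * t).
have dm t : is_derive t 1 m (m' t).
  have dgN : is_derive t 1 (g \o -%R) (g' (- t) * -1).
    by apply: is_derive1_comp.
  have -> : m = (g + (g \o -%R)) - M \*: (id * id : R -> R).
    by apply/funext => s; rewrite /m expr2.
  apply: is_derive_eq.
  by rewrite /m' mulrN1 [t%:A]mulr1 -mulr2n -[t *+ 2]mulr_natl.
have d20 : 0 < d / 2 by rewrite divr_gt0.
have d2d : d / 2 < d by rewrite ltr_pdivrMr// ltr_pMr// ltr1n.
have [] := MVT d20 (fun x _ => dm x).
  apply: derivable_within_continuous => x _; exact: (@ex_derive _ _ _ _ _ _ _ (dm x)).
move=> c; rewrite in_itv/= => /andP[c0 cd].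
rewrite [in RHS]subr0 /m oppr0 expr0n mulr0 => mc.
have [_ h2] := H (d / 2) ltac:(by rewrite gtr0_norm).
have [+ _] := H c ltac:(by rewrite gtr0_norm//; exact: lt_trans cd d2d).
have [+ _] := H (- c) ltac:(by rewrite normrN gtr0_norm//; exact: lt_trans cd d2d).
rewrite normrN (gtr0_norm c0) !ler_norml => /andP[_ h3] /andP[h4 _].
have : m' c <= 0 by rewrite -(pmulr_lle0 _ d20) -mc; lra.
have : 0 < (b - M) * c by rewrite mulr_gt0// subr_gt0.
by rewrite /m'; lra.
Unshelve. all: by end_near. Qed.
End one_variable.

(** * Restriction to lines: gradient, Hessian form and the equation *)

Section several_variables.
Context {R : realType} {n : nat}.
Implicit Types (x y v p q : 'rV[R]_n) (f u : 'rV[R]_n -> R) (s t a C M : R).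

Lemma diff_dot f x v : differentiable f x -> 'd f x v = dot v (grad f x).
Proof.
move=> df; rewrite [in LHS](row_sum_delta v) linear_sum; apply: eq_bigr => i _.
by rewrite linearZ mxE /partial deriveE.
Qed.

Lemma is_derive_line f x v t : differentiable f (x + t *: v) ->
  is_derive t 1 (fun s => f (x + s *: v)) (dot v (grad f (x + t *: v))).
Proof.
move=> df; rewrite -diff_dot// -deriveE//.
have quotE : (fun h : R => h^-1 *: (((fun s => f (x + s *: v)) \o shift t) (h *: 1)
      - f (x + t *: v))) =
    (fun h : R => h^-1 *: ((f \o shift (x + t *: v)) (h *: v) - f (x + t *: v))).
  apply/funext => h /=; congr (_ *: (f _ - _)).
  by rewrite [h *: 1]mulr1 scalerDl addrCA addrA.
by split; rewrite ?/derivable ?/derive quotE//; exact: diff_derivable.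
Qed.

Definition hess u x v : R :=
  \sum_(i < n) \sum_(j < n) v 0 i * v 0 j * partial j (partial i u) x.

Lemma is_derive_line2 u x v t : C2 u ->
  is_derive t 1 (fun s => dot v (grad u (x + s *: v))) (hess u (x + t *: v) v).
Proof.
move=> [_ d2u].
have -> : (fun s => dot v (grad u (x + s *: v))) =
    \sum_(i < n) (v 0 i \*: (fun s => partial i u (x + s *: v))).
  apply/funext => s; rewrite fct_sumE; apply: eq_bigr => i _.
  by rewrite mxE.
have dpartial i : is_derive t 1 (fun s => partial i u (x + s *: v))
    (dot v (grad (partial i u) (x + t *: v))).
  by apply: is_derive_line; exact: (d2u i).1.
apply: is_derive_eq; apply: eq_bigr => i _; rewrite [LHS]mulr_sumr.
by apply: eq_bigr => j _; rewrite mxE mulrA.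
Qed.

Lemma hess_le u x v M : C2 u ->
  (\forall t \near 0, u (x + t *: v) + u (x - t *: v) - 2 * u x <= M * t ^+ 2) ->
  hess u x v <= M.
Proof.
move=> cu uM.
have H := @second_derive_le R (fun t => u (x + t *: v))
  (fun t => dot v (grad u (x + t *: v))) (hess u x v) M.
apply: H => [t||].
- by apply: is_derive_line; exact: cu.1.1.
- by have := is_derive_line2 x v 0 cu; rewrite scale0r addr0.
- by rewrite scale0r addr0; near=> t; rewrite scaleNr; near: t.
Unshelve. all: by end_near. Qed.

Lemma convex_hess_ge0 u x v : C2 u -> convex u -> 0 <= hess u x v.
Proof.
move=> cu /convexP cvu; rewrite -oppr_le0.
have H := @second_derive_le R (fun t => - u (x + t *: v))
  (fun t => - dot v (grad u (x + t *: v))) (- hess u x v) 0.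
apply: H => [t||].
- by apply: is_deriveN; apply: is_derive_line; exact: cu.1.1.
- apply: is_deriveN.
  by have := is_derive_line2 x v 0 cu; rewrite scale0r addr0.
- rewrite scale0r addr0; near=> t; rewrite scaleNr mul0r.
  (* Midpoint convexity says that symmetric second differences are nonnegative. *)
  have := cvu (x + t *: v) (x - t *: v) (1 / 2) ltac:(by apply/andP; split; lra).
  rewrite (_ : 1 / 2 *: _ + _ = x); first by lra.
  by apply/rowP => i; rewrite !mxE; field.
Unshelve. all: by end_near. Qed.

(** The coefficient matrix is the identity plus a rank-one multiple of [Du] times its transpose, so
    the operator is a sum of second derivatives along lines: the coordinate directions and the
    gradient direction. *)
Lemma equation_hess C u x : solves_equation C u ->
  \sum_(i < n) hess u x (delta_mx 0 i) +
    hess u x (grad u x) / (1 - enorm (grad u x) ^+ 2) =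
  C * Num.sqrt (1 - enorm (grad u x) ^+ 2) - 1.
Proof.
move=> /(_ x) <-; rewrite mulr_suml -big_split; apply: eq_bigr => i _ /=.
rewrite {1}/hess (bigD1 i)//= [X in _ + X + _]big1 ?addr0; last first.
  move=> k ki; rewrite big1// => j _; rewrite !mxE/= (negbTE ki).
  by rewrite !mul0r.
rewrite mulr_suml -big_split; apply: eq_bigr => j _ /=.
by rewrite !mxE !eqxx/= mul1r (eq_sym j); ring.
Qed.

(** Mean value theorem on the segment, then Cauchy-Schwarz. *)
Lemma lipschitz_of_grad f M : (forall x, differentiable f x) ->
  (forall x, enorm (grad f x) <= M) ->
  forall x y, f y - f x <= M * enorm (y - x).
Proof.
move=> df gM x y.
have dl t : is_derive t 1 (fun s => f (x + s *: (y - x)))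
    (dot (y - x) (grad f (x + t *: (y - x)))) by exact: is_derive_line.
have [] := MVT (@ltr01 R) (fun t _ => dl t).
  apply: derivable_within_continuous => t _.
  exact: (@ex_derive _ _ _ _ _ _ _ (dl t)).
move=> c _; rewrite scale1r scale0r addr0 [x + _]addrC subrK subr0 mulr1 => ->.
rewrite (le_trans (dot_le_enorm _ _))// mulrC ler_wpM2r ?enorm_ge0//.
Qed.

End several_variables.

(** * Gradient bound and hyperboloid barrier for a solution *)

Section solution.
Context {R : realType} {n : nat} {C : R} {u : 'rV[R]_n -> R}.
Implicit Types (x y v p q : 'rV[R]_n) (a r s t eps rho : R).
Hypotheses (hC : 1 < C) (hC2 : C2 u) (hsol : solves_equation C u).

Let C_gt0 : 0 < C. Proof. exact: lt_trans hC. Qed.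

Lemma grad_le_slope (hconv : convex u) (hspace : spacelike u) x :
  enorm (grad u x) <= Num.sqrt (1 - 1 / C ^+ 2).
Proof.
set p := grad u x.
have p1 : enorm p ^+ 2 < 1 by rewrite expr_lt1// ?enorm_ge0//; exact: hspace.
have w0 : 0 < 1 - enorm p ^+ 2 by rewrite subr_gt0.
(* All second derivatives of a convex function along lines are nonnegative, hence so is the
   right-hand side of the equation. *)
have : 1 <= C * Num.sqrt (1 - enorm p ^+ 2).
  rewrite -subr_ge0 -equation_hess// addr_ge0//.
    by apply: sumr_ge0 => i _; exact: convex_hess_ge0.
  by rewrite divr_ge0 ?(ltW w0)//; exact: convex_hess_ge0.
rewrite -ler_sqr ?nnegrE ?mulr_ge0 ?sqrtr_ge0 ?(ltW C_gt0)//.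
rewrite expr1n exprMn sqr_sqrtr ?(ltW w0)// mulrC -ler_pdivrMr ?exprn_gt0// => h.
rewrite -(ger0_norm (enorm_ge0 p)) -sqrtr_sqr ler_wsqrtr//.
by move: h; lra.
Qed.

(** A paraboloid touching from above bounds both [|Du|] and the Hessian form at the contact point;
    both sides of the equation are then estimated, the right-hand side being decreasing in
    [|Du|]. *)
Lemma touching_paraboloid x q (a K : R) : 0 <= K -> enorm q <= a -> a < 1 ->
  (forall v, \forall t \near 0,
     u (x + t *: v) <= u x + t * dot v q + K * t ^+ 2 * enorm v ^+ 2) ->
  C * Num.sqrt (1 - a ^+ 2) - 1 <= 2 * K * (n%:R + 1 / (1 - a ^+ 2)).
Proof.
move=> K0 qa a1 touch; set p := grad u x.
have a0 : 0 <= a := le_trans (enorm_ge0 q) qa.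
have N0 : -%R @ (0 : R) --> (0 : R).
  by rewrite -[X in _ --> X]oppr0; exact: opp_continuous.
(* Adding the touching inequalities at [t] and [- t] cancels the linear terms. *)
have hK v : hess u x v <= 2 * K * enorm v ^+ 2.
  apply: hess_le => //; near=> t.
  have tv : u (x + t *: v) <= u x + t * dot v q + K * t ^+ 2 * enorm v ^+ 2.
    by near: t; exact: touch.
  have : u (x + (- t) *: v) <= u x + - t * dot v q + K * (- t) ^+ 2 * enorm v ^+ 2.
    by near: t; exact: (N0 _ (touch v)).
  by rewrite scaleNr sqrrN; move: tv; lra.
have pa : enorm p <= a.
  apply: le_trans qa.
  (* Touching in the direction [p] itself compares the slopes: [p.p <= p.q]. *)
  have : enorm p * enorm p <= enorm p * enorm q.
    apply: le_trans (dot_le_enorm p q); rewrite -expr2 enorm_sqr.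
    have := @is_derive_line R n u x p 0 (hC2.1.1 _).
    rewrite scale0r addr0 => dl.
    apply: (derive_le_of_quadratic (K := K * enorm p ^+ 2) dl).
    rewrite scale0r addr0; near=> t => _.
    rewrite mulrAC; near: t; exact: touch.
  by have := enorm_ge0 p; rewrite le_eqVlt => /predU1P[<-|pp];
    rewrite ?enorm_ge0// ler_pM2l.
have w0 : 0 < 1 - a ^+ 2 by rewrite subr_gt0 expr_lt1.
have wp : 1 - a ^+ 2 <= 1 - enorm p ^+ 2.
  by rewrite lerD2l lerN2 ler_sqr ?nnegrE// enorm_ge0.
have wp0 := lt_le_trans w0 wp.
apply: (@le_trans _ _ (C * Num.sqrt (1 - enorm p ^+ 2) - 1)).
  by rewrite lerD2r ler_pM2l// ler_wsqrtr.
rewrite -equation_hess// mulrDr lerD//.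
  rewrite -[X in _ * X%:R]card_ord mulr_natr -sumr_const ler_sum// => i _.
  apply: le_trans (hK _) _.
  rewrite enorm_sqr /dot (bigD1 i)//= big1; last first.
    by move=> j ji; rewrite !mxE (negbTE ji) mulr0.
  by rewrite !mxE !eqxx addr0 !mulr1.
apply: (@le_trans _ _ (2 * K * 1 / (1 - enorm p ^+ 2))).
  rewrite ler_pM2r ?invr_gt0//; apply: le_trans (hK _) _.
  rewrite ler_wpM2l ?mulr_ge0// expr_le1// ?enorm_ge0//.
  exact: le_trans pa (ltW a1).
by rewrite -mulrA ler_wpM2l ?mulr_ge0// !mul1r lef_pV2.
Unshelve. all: by end_near. Qed.

Lemma sphere_growth a : 0 <= a -> a < 1 -> 1 < C * Num.sqrt (1 - a ^+ 2) ->
  exists2 eps, 0 < eps & forall x rho, 0 < rho ->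
    exists2 y, enorm (y - x) = rho & u x + a * (rho - eps) <= u y.
Proof.
move=> a0 a1; rewrite -subr_gt0; set c := _ - 1 => c0.
set N : R := n%:R + 1 / (1 - a ^+ 2).
have w0 : 0 < 1 - a ^+ 2 by rewrite subr_gt0 expr_lt1.
have N0 : 0 <= N by rewrite addr_ge0// divr_ge0// ltW.
(* Chosen so that [a * N / eps < c], which contradicts the touching estimate with
   [K = a / (2 * eps)]. *)
set eps := (a * N + 1) / c.
have eps0 : 0 < eps by rewrite divr_gt0// ltr_wpDl// mulr_ge0.
exists eps => // x rho rho0.
pose phi y := a * Num.sqrt (enorm (y - x) ^+ 2 + eps ^+ 2).
have cphi : continuous phi.
  have cg : continuous (fun r : R => a * Num.sqrt (r ^+ 2 + eps ^+ 2)).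
    have sq : continuous (fun r : R => r ^+ 2 + eps ^+ 2).
      by move=> r; apply: cvgD; [exact: exprn_continuous|exact: cvg_cst].
    move=> r; apply: cvgM; first exact: cvg_cst.
    exact: (continuous_comp (sq r) (@sqrt_continuous _ _)).
  move=> y; exact: (continuous_comp (@enormB_continuous _ _ x y) (cg _)).
have [||y0] := @EVT_max_rV R n (fun y => u y - phi y) _ _
  (@closed_ball_compact _ _ x rho).
- by exists x; rewrite /= subrr enorm0 ltW.
- apply: continuous_subspaceT => y.
  exact: (continuousB (differentiable_continuous (hC2.1.1 y)) (cphi y)).
rewrite inE /= => y0rho maxy0.
have {maxy0} ymax y : enorm (y - x) <= rho -> u y - phi y <= u y0 - phi y0.
  by move=> yr; apply: maxy0; rewrite inE.
have s_gt0 r : 0 < r ^+ 2 + eps ^+ 2 by rewrite ltr_wpDl ?sqr_ge0// exprn_gt0.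
(* A maximum of [u - phi] on the boundary gives the claim by comparison with the centre, since
   [phi x = a * eps] and [phi >= a * rho] on the sphere. *)
move: y0rho; rewrite le_eqVlt => /predU1P[y0rho|y0rho].
  exists y0 => //; have := ymax x.
  rewrite subrr enorm0 => /(_ (ltW rho0)); rewrite /phi subrr enorm0 y0rho.
  rewrite expr0n add0r sqrtr_sqr (gtr0_norm eps0).
  have : a * rho <= a * Num.sqrt (rho ^+ 2 + eps ^+ 2).
    rewrite ler_wpM2l// -[leLHS](gtr0_norm rho0) -sqrtr_sqr ler_wsqrtr// lerDl.
    exact: sqr_ge0.
  by lra.
exfalso.
set r0 := Num.sqrt (enorm (y0 - x) ^+ 2 + eps ^+ 2).
have r0eps : eps <= r0.
  by rewrite -[leLHS](gtr0_norm eps0) -sqrtr_sqr ler_wsqrtr// lerDr sqr_ge0.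
have r0y : enorm (y0 - x) <= r0.
  rewrite -[leLHS](ger0_norm (enorm_ge0 _)) -sqrtr_sqr ler_wsqrtr// lerDl.
  exact: sqr_ge0.
have r00 := lt_le_trans eps0 r0eps.
have eps20 : 0 < 2 * eps by exact: mulr_gt0.
have r020 : 0 < 2 * r0 by exact: mulr_gt0.
have r0sq : r0 ^+ 2 = enorm (y0 - x) ^+ 2 + eps ^+ 2 by rewrite sqr_sqrtr// ltW.
(* At an interior maximum, [phi] plus a constant touches [u] from above; its slope there is
   [a / r0 *: (y0 - x)]. *)
have : c <= 2 * (a / (2 * eps)) * N.
  apply: (@touching_paraboloid y0 (a / r0 *: (y0 - x))) => //.
  - by rewrite divr_ge0// mulr_ge0// ltW.
  - rewrite enormZ ger0_norm ?divr_ge0 ?(ltW r00)// mulrAC ler_pdivrMr//.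
    by rewrite ler_wpM2l.
  move=> v; near=> t.
  have tin : enorm (y0 + t *: v - x) < rho.
    near: t.
    have linec : {for 0, continuous (fun t : R => y0 + t *: v)}.
      by apply: continuousD; [exact: cst_continuous|exact: scalel_continuous].
    have := continuous_comp linec (@enormB_continuous _ _ x _).
    rewrite /prop_for /continuous_at /=; rewrite scale0r addr0 => /cvgr_lt; exact.
  have := ymax _ (ltW tin); rewrite /phi -/r0.
  set s := Num.sqrt _ => hs.
  have ssq : s ^+ 2 = r0 ^+ 2 + 2 * t * dot v (y0 - x) + t ^+ 2 * enorm v ^+ 2.
    rewrite sqr_sqrtr ?ltW// r0sq (addrAC y0) (enormD_sqr (y0 - x)) enormZ exprMn.
    by rewrite real_normK ?num_real// dotZr (dotC v); ring.
  (* Concavity of the square root replaces the hyperboloid by a paraboloid, because [s ^+ 2] is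
     exactly quadratic in [t]. *)
  have : s - r0 <= (s ^+ 2 - r0 ^+ 2) / (2 * r0).
    rewrite ler_pdivlMr ?mulr_gt0//.
    by have := sqr_ge0 (s - r0); rewrite sqrrB; lra.
  move=> /(ler_wpM2l a0); rewrite ssq dotZr.
  have -> : a * ((r0 ^+ 2 + 2 * t * dot v (y0 - x) + t ^+ 2 * enorm v ^+ 2
    - r0 ^+ 2) / (2 * r0)) = t * (a / r0 * dot v (y0 - x))
      + a / (2 * r0) * t ^+ 2 * enorm v ^+ 2.
    by field; rewrite gt_eqF.
  have : a / (2 * r0) * t ^+ 2 * enorm v ^+ 2 <= a / (2 * eps) * t ^+ 2 * enorm v ^+ 2.
    rewrite !ler_wpM2r ?sqr_ge0// ler_wpM2l// lef_pV2 ?posrE//.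
    by rewrite ler_pM2l.
  by move: hs; lra.
have -> : 2 * (a / (2 * eps)) * N = a * N / eps by field; rewrite gt_eqF.
rewrite ler_pdivlMr// /eps mulrC divfK ?gt_eqF//; lra.
Unshelve. all: by end_near. Qed.

End solution.

(** * Existence and properties of the blowdown *)

Section blowdown.
Context {R : realType} {n : nat} {u : 'rV[R]_n -> R} {k : R}.
Implicit Types (x y v p : 'rV[R]_n) (a h e t delta : R).
Hypotheses (hconv : convex u) (hu0 : u 0 = 0).
Hypothesis hlip : forall x y, u y - u x <= k * enorm (y - x).

(** Convexity on the segment from 0 to [h' *: x], with weight [h / h'] and [u 0 = 0]. *)
Lemma rescaling_nondecreasing x h h' : 0 < h -> h <= h' ->
  rescaling u h x <= rescaling u h' x.
Proof.
move=> h0 hh'; have h'0 := lt_le_trans h0 hh'.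
have := (convexP u).1 hconv (h' *: x) 0 (h / h').
rewrite ler_pdivrMr// mul1r hh' divr_ge0 ?(ltW h0) ?(ltW h'0)// => /(_ isT).
rewrite scaler0 addr0 hu0 mulr0 addr0 scalerA divfK ?gt_eqF// => H.
by rewrite /rescaling ler_pdivrMr// -mulrA mulrC (mulrC h'^-1).
Qed.

Lemma rescaling_lipschitz x y h : 0 < h ->
  rescaling u h y - rescaling u h x <= k * enorm (y - x).
Proof.
move=> h0; rewrite /rescaling -mulrBl ler_pdivrMr//.
apply: le_trans (hlip _ _) _.
by rewrite -scalerBr enormZ gtr0_norm// mulrCA mulrC.
Qed.

Let quotients x := [set rescaling u h x | h in [set h | 0 < h]].

Lemma quotients_has_sup x : has_sup (quotients x).
Proof.
split; first by exists (rescaling u 1 x), 1 => /=.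
exists (k * enorm x) => _ [h /= h0 <-].
have := rescaling_lipschitz 0 x h0.
by rewrite /rescaling scaler0 hu0 mul0r !subr0.
Qed.

Lemma rescaling_cvg_sup x : rescaling u h x @[h --> +oo] --> sup (quotients x).
Proof.
have hs := quotients_has_sup x.
apply/cvgrPdist_le => e e0.
have [_ [h0 /= h00 <-] /ltW eh0] := sup_adherent e0 hs.
near=> h.
have h0h : h0 <= h by near: h; apply: nbhs_pinfty_ge; rewrite num_real.
have hsup : rescaling u h x <= sup (quotients x).
  by apply: sup_ubound; [exact: hs.2|exists h => //=; exact: lt_le_trans h0h].
have := rescaling_nondecreasing x h00 h0h.
by rewrite ger0_norm ?subr_ge0//; move: eh0; lra.
Unshelve. all: by end_near. Qed.

Lemma rescaling_cvg x : cvg (rescaling u h x @[h --> +oo]).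
Proof. by apply: cvgP; exact: rescaling_cvg_sup. Qed.

Lemma blowdownE x : blowdown u x = sup (quotients x).
Proof. by apply: cvg_lim => //; exact: rescaling_cvg_sup. Qed.

Lemma rescaling_le_blowdown x h : 0 < h -> rescaling u h x <= blowdown u x.
Proof.
move=> h0; rewrite blowdownE; apply: sup_ubound; last by exists h.
exact: (quotients_has_sup x).2.
Qed.

(** The least-upper-bound property, through which each inequality for the blowdown reduces to one
    for a single rescaling. *)
Lemma blowdown_le x a : (forall h, 0 < h -> rescaling u h x <= a) ->
  blowdown u x <= a.
Proof.
move=> ha; rewrite blowdownE; apply: sup_le_ub; first exact: (quotients_has_sup x).1.
by move=> _ [h /= h0 <-]; exact: ha.
Qed.

Lemma blowdown_lipschitz x y : blowdown u y - blowdown u x <= k * enorm (y - x).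
Proof.
rewrite lerBlDr; apply: blowdown_le => h h0.
have := rescaling_lipschitz x y h0; have := rescaling_le_blowdown x h0; lra.
Qed.

Lemma blowdown_homogeneous : pos_homogeneous1 (blowdown u).
Proof.
(* The rescaling of [t *: x] at scale [h] is [t] times that of [x] at scale [h * t]. The reverse
   inequality comes from the factor [t^-1]. *)
have le_homog t x : 0 < t -> blowdown u (t *: x) <= t * blowdown u x.
  move=> t0; apply: blowdown_le => h h0.
  have := rescaling_le_blowdown x (mulr_gt0 h0 t0).
  rewrite -(ler_pM2l t0); apply: le_trans.
  by rewrite /rescaling scalerA le_eqVlt; apply/orP; left; apply/eqP; field;
    rewrite !gt_eqF.
move=> t x t0; apply/le_anti; rewrite le_homog//=.
have t'0 : 0 < t^-1 by rewrite invr_gt0.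
have := le_homog _ (t *: x) t'0.
by rewrite scalerA mulVf ?gt_eqF// scale1r ler_pdivlMl.
Qed.

Lemma blowdown_convex : convex (blowdown u).
Proof.
apply/convexP => x y t t01; apply: blowdown_le => h h0.
have [t0 t1] := andP t01; have t10 : 0 <= 1 - t by rewrite subr_ge0.
have := ler_wpM2l t0 (rescaling_le_blowdown x h0).
have := ler_wpM2l t10 (rescaling_le_blowdown y h0).
have := (convexP u).1 hconv (h *: x) (h *: y) t t01.
rewrite /rescaling scalerDr !scalerA ![h * _]mulrC => H.
have : u ((t * h) *: x + ((1 - t) * h) *: y) / h <=
    t * (u (h *: x) / h) + (1 - t) * (u (h *: y) / h).
  by rewrite !mulrA -mulrDl ler_pM2r ?invr_gt0.
by lra.
Qed.

Lemma blowdown_continuous : 0 <= k -> continuous (blowdown u).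
Proof.
move=> k0 x.
have FF : Filter (nbhs x) by exact: nbhs_filter.
apply/(@cvgrPdist_le _ _ _ (nbhs x) FF) => e e0; near=> y.
have yx : enorm (y - x) < e / (k + 1).
  near: y.
  have := @enormB_continuous _ _ x x.
  rewrite /continuous_at subrr enorm0 => /cvgr_lt; apply.
  by rewrite divr_gt0// ltr_wpDl.
have k10 : 0 < k + 1 by rewrite ltr_wpDl.
have ke : k * enorm (y - x) <= e.
  rewrite ltr_pdivlMr// in yx; apply: le_trans (ltW yx).
  by rewrite mulrC ler_wpM2l ?enorm_ge0// lerDl.
have := blowdown_lipschitz x y; have := blowdown_lipschitz y x.
rewrite -enormN opprB ler_norml; move: ke; lra.
Unshelve. all: by end_near. Qed.

(** Growth around [h' *: x] at radius [h' * delta] loses only [a * eps / h'] after rescaling. The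
    sphere point varies with [h'], so the conclusion is phrased through an upper bound [M] on the
    sphere. *)
Lemma blowdown_growth a eps x delta : 0 <= a -> 0 < eps ->
    (forall x rho, 0 < rho ->
      exists2 y, enorm (y - x) = rho & u x + a * (rho - eps) <= u y) ->
    0 < delta -> forall M, (forall y, enorm (y - x) = delta -> blowdown u y <= M) ->
  blowdown u x + a * delta <= M.
Proof.
move=> a0 eps0 growth delta0 M VM; rewrite -lerBrDr; apply: blowdown_le => h h0.
apply/ler_addgt0Pr => e e0.
have step h' : 0 < h' -> rescaling u h' x <= M - a * delta + a * eps / h'.
  move=> h'0; have [y yx uy] := growth (h' *: x) _ (mulr_gt0 h'0 delta0).
  have ydelta : enorm (h'^-1 *: y - x) = delta.
    apply: (mulfI (lt0r_neq0 h'0)).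
    rewrite -yx -{1}(gtr0_norm h'0) -enormZ scalerBr scalerA divff ?gt_eqF//.
    by rewrite scale1r.
  have := le_trans (rescaling_le_blowdown (h'^-1 *: y) h'0) (VM _ ydelta).
  rewrite /rescaling scalerA divff ?gt_eqF// scale1r => uyM.
  have : (u (h' *: x) + a * (h' * delta - eps)) / h' <= u y / h'.
    by rewrite ler_pM2r// invr_gt0.
  rewrite (_ : (_ + _) / h' = u (h' *: x) / h' + a * delta - a * eps / h').
    by move: uyM; lra.
  by field; rewrite gt_eqF.
(* Large enough for an error of at most [e], and at least [h], so that monotonicity carries the
   bound back to [h]. *)
set h' := Num.max h (a * eps / e).
have hh' : h <= h' by rewrite le_max lexx.
have h'0 := lt_le_trans h0 hh'.
have : a * eps / h' <= e.
  by rewrite ler_pdivrMr// -ler_pdivrMl// mulrC le_max lexx orbT.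
have := rescaling_nondecreasing x h0 hh'; have := step _ h'0; lra.
Qed.

End blowdown.

(** * Gradient length at points of differentiability *)

Section gradient.
Context {R : realType} {n : nat} {V : 'rV[R]_n -> R} {k : R}.
Implicit Types (x y : 'rV[R]_n) (delta : R).
Hypothesis k_ge0 : 0 <= k.
Hypothesis V_lip : forall x y, V y - V x <= k * enorm (y - x).
Hypothesis V_sphere : forall x delta, 0 < delta -> exists y,
  enorm (y - x) = delta /\ `|V x - V y| = k * delta.

Lemma enorm_grad_eq x : differentiable V x -> enorm (grad V x) = k.
Proof.
move=> dV; set p := grad V x; apply/le_anti/andP; split.
  (* The derivative in the direction [p] is [p.p], and the Lipschitz bound limits it to
     [k * |p|]. *)
  have : enorm p * enorm p <= enorm p * k.
    have := @is_derive_line R n V x p 0.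
    rewrite scale0r addr0 -/p => /(_ dV) dl.
    rewrite -expr2 enorm_sqr; apply: (derive_le_of_quadratic (K := 0) dl).
    rewrite scale0r addr0; near=> t => t0.
    rewrite mul0r addr0 -lerBlDl; apply: le_trans (V_lip _ _) _.
    by rewrite addrAC subrr add0r enormZ gtr0_norm// mulrCA (mulrC k).
  have [->//|p0] := eqVneq (enorm p) 0.
  by rewrite ler_pM2l// lt_neqAle eq_sym p0 enorm_ge0.
(* On a small sphere of radius [d / 2] the value changes somewhere by exactly [k * (d / 2)], while
   the linear expansion allows at most [(|p| + e) * (d / 2)]. *)
apply/ler_addgt0Pr => e e0.
have /eqaddoP/(_ _ e0)/nbhs_normP[d /= d0 H] := diff_locally dV.
have d20 : 0 < d / 2 by rewrite divr_gt0.
have [y [yx Vxy]] := V_sphere x d20.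
have yxd : enorm (y - x) < d by rewrite yx ltr_pdivrMr// ltr_pMr// ltr1n.
have := H (y - x).
rewrite /= sub0r normrN (le_lt_trans (norm_le_enorm _) yxd) => /(_ isT).
rewrite (_ : (V \o _ - _) (y - x) = V (y - x + x) - (V x + 'd V x (y - x)))//.
rewrite subrK diff_dot// -/p => Vp.
have dp := dot_le_enorm (y - x) p.
have dpN := dot_le_enorm (y - x) (- p).
rewrite enormN -(scaleN1r p) dotZr yx in dpN; rewrite yx in dp.
have we : e * `|y - x| <= e * (d / 2).
  by rewrite ler_wpM2l ?(ltW e0)// -yx norm_le_enorm.
rewrite -(ler_pM2r d20) -Vxy ler_norml.
move: Vp; rewrite ler_norml => /andP[Vp1 Vp2].
by apply/andP; split; move: Vp1 Vp2 dp dpN we; lra.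
Unshelve. all: by end_near. Qed.

End gradient.

(** * Attainment of the slope on spheres, and conclusion *)

Theorem proposition4p1 (R : realType) (n : nat) (C : R) (u : 'rV[R]_n -> R)
    (hC : 1 < C) (hC2 : C2 u) (hconv : convex u) (hspace : spacelike u)
    (hsol : solves_equation C u) (hu0 : u 0 = 0) :
  (forall x : 'rV[R]_n, cvg (rescaling u h x @[h --> +oo])) /\
  pos_homogeneous1 (blowdown u) /\
  convex (blowdown u) /\
  (forall (x : 'rV[R]_n) (delta : R), 0 < delta ->
     exists y : 'rV[R]_n,
       enorm (y - x) = delta /\
       `|blowdown u x - blowdown u y| = Num.sqrt (1 - 1 / C ^+ 2) * delta) /\
  (forall x : 'rV[R]_n, differentiable (blowdown u) x ->
     enorm (grad (blowdown u) x) = Num.sqrt (1 - 1 / C ^+ 2)).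
Proof.
set k := Num.sqrt _.
have C0 : 0 < C := lt_trans ltr01 hC.
have C20 : 0 < C ^+ 2 by rewrite exprn_gt0.
have k0 : 0 < k.
  by rewrite sqrtr_gt0 subr_gt0 ltr_pdivrMr// mul1r exprn_egt1// ltW.
have ksq : k ^+ 2 = 1 - 1 / C ^+ 2.
  by rewrite sqr_sqrtr// subr_ge0 ler_pdivrMr// mul1r exprn_ege1// ltW.
have lip : forall x y, u y - u x <= k * enorm (y - x).
  apply: lipschitz_of_grad; first exact: hC2.1.1.
  exact: (grad_le_slope hC hC2 hsol hconv hspace).
have Vlip := blowdown_lipschitz hconv hu0 lip.
have Vsphere (x : 'rV[R]_n) (delta : R) : 0 < delta -> exists y,
    enorm (y - x) = delta /\ `|blowdown u x - blowdown u y| = k * delta.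
  move=> delta0.
  (* The slope [k] is where [C * sqrt (1 - k^2) = 1], so any smaller slope satisfies the strict
     inequality of [sphere_growth]. *)
  have growth a : 0 <= a -> a < k -> exists2 eps, 0 < eps & forall z rho, 0 < rho ->
      exists2 y, enorm (y - z) = rho & u z + a * (rho - eps) <= u y.
    move=> a0 ak.
    have aC : a ^+ 2 < 1 - 1 / C ^+ 2 by rewrite -ksq ltr_sqr ?nnegrE// ltW.
    have a1 : a < 1.
      rewrite -(@expr_lt1 _ 2)//; apply: lt_trans aC _.
      by rewrite ltrBlDr ltrDl divr_gt0.
    apply: (sphere_growth hC hC2 hsol a0 a1).
    rewrite -ltr_sqr ?nnegrE ?mulr_ge0 ?sqrtr_ge0 ?(ltW C0)//.
    rewrite expr1n exprMn sqr_sqrtr; last first.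
      by rewrite subr_ge0 expr_le1// ltW.
    by rewrite mulrC -ltr_pdivrMr//; move: aC; lra.
  have cV := blowdown_continuous hconv hu0 lip (ltW k0).
  have [||y] := @EVT_max_rV R n (blowdown u) _ _ (@sphere_compact _ _ x delta).
  (* Growth with slope 0 supplies a point of the sphere, in every dimension. *)
  - by have [eps _ H] := growth 0 (lexx _) k0; have [y yx _] := H x delta delta0;
      exists y.
  - exact: continuous_subspaceT.
  rewrite inE /= => yx ymax; exists y; split=> //.
  have {}ymax z : enorm (z - x) = delta -> blowdown u z <= blowdown u y.
    by move=> zx; apply: ymax; rewrite inE.
  have upper : blowdown u y - blowdown u x <= k * delta by rewrite -yx.
  have lower : k * delta <= blowdown u y - blowdown u x.
    rewrite leNgt -ltr_pdivrMr//; apply/negP => Vk.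
    (* The slope [(b + k) / 2] lies strictly between the supposed maximal ratio and [k]; the maximum
       with 0 keeps it nonnegative. *)
    pose b := Num.max 0 ((blowdown u y - blowdown u x) / delta).
    have b0 : 0 <= b by rewrite le_max lexx.
    have bk : b < k by rewrite gt_max k0.
    have [eps eps0 H] := growth ((b + k) / 2) ltac:(lra) ltac:(lra).
    have := blowdown_growth hconv hu0 lip (a := (b + k) / 2) ltac:(lra) eps0 H
      delta0 ymax.
    rewrite -lerBrDl -ler_pdivlMr// => h.
    have : (blowdown u y - blowdown u x) / delta <= b by rewrite le_max lexx orbT.
    by move: h bk; lra.
  rewrite distrC ger0_norm; first by apply/le_anti/andP.
  by apply: le_trans lower; rewrite mulr_ge0// ltW.
split; first exact: (rescaling_cvg hconv hu0 lip).
split; first exact: (blowdown_homogeneous hconv hu0 lip).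
split; first exact: (blowdown_convex hconv hu0 lip).
split; first exact: Vsphere.
move=> x dV; exact: (enorm_grad_eq (ltW k0) Vlip Vsphere dV).
Qed.
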